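(* Let a Markov chain with a purely finitely additive (Markov) kernel $P(x,E)$ be given on an arbitrary discrete space $(X,\Sigma_d)$, and let $A$ be the Markov operator generated by it, $A\mu(E)=\int_X P(x,E)\,\mu(dx)$, $\mu\in ba(X,\Sigma_d)$, $E\in\Sigma_d$. Then there exists an invariant finitely additive probability measure $\mu=A\mu\in V_{ba}$, and all invariant measures of $A$ are purely finitely additive; that is, $\Delta_{ba}=\Delta_{pfa}\neq\emptyset$ and $\Delta_{ca}=\emptyset$.
   Context: ''Arbitrary discrete space'' $(X,\Sigma_d)$: $X$ is an infinite set, $\Sigma_d=2^X$ is the sigma-algebra of all subsets of $X$, and the cardinality of $X$ is ''immeasurable'', meaning that every finite countably additive measure on $2^X$ that is zero on every one-point set is identically zero. $B(X,\Sigma_d)$ is the space of bounded $\Sigma_d$-measurable functions $X\to\mathbb R$. $ba(X,\Sigma_d)$ and $ca(X,\Sigma_d)$ are the spaces of bounded real-valued finitely additive, respectively countably additive, measures on $\Sigma_d$. A finitely additive measure $\mu\ge0$ is purely finitely additive if every countably additive measure $\lambda$ with $0\le\lambda\le\mu$ is identically zero; a signed measure is purely finitely additive if both components of its Jordan decomposition are. $pfa(X,\Sigma_d)$ is the space of bounded purely finitely additive measures. A purely finitely additive Markov kernel is a function $P(x,E)$, $x\in X$, $E\in\Sigma_d$, with $0\le P(x,E)\le1$, $P(\cdot,E)\in B(X,\Sigma_d)$ for all $E$, $P(x,\cdot)\in pfa(X,\Sigma_d)$ and $P(x,X)=1$ for all $x$. Integrals of bounded functions against bounded finitely additive measures are Radon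 integrals (the sup-norm continuous extension of the integral of simple functions). For $\ast\in\{ba,ca,pfa\}$, $V_\ast$ is the set of nonnegative measures $\mu\in\ast(X,\Sigma_d)$ with $\mu(X)\le1$. A measure in $V_\ast$ is a probability measure if $\mu(X)=1$. An invariant measure is a positive finitely additive measure with $A\mu=\mu$. $\Delta_\ast$ is the set of all nonzero measures $\mu\in V_\ast$ with $A\mu=\mu$. *)

(* Defs.v *)
From HB Require Import structures.
From mathcomp Require Import all_boot all_order all_algebra.
From mathcomp Require Import all_classical all_reals all_analysis.

Set Implicit Arguments.
Unset Strict Implicit.
Unset Printing Implicit Defensive.

Import Order.TTheory GRing.Theory Num.Theory.
Import numFieldNormedType.Exports HBSimple.

Local Open Scope classical_set_scope.
Local Open Scope ring_scope.

(* A real-valued set function [mu : set X -> R] is only meaningful on the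
   measurable sets; all comparisons below are restricted to them. *)
Section set_functions.
Context d (X : measurableType d) (R : realType).
Implicit Types (mu la : set X -> R) (f : X -> R).

Definition B : set (X -> R) :=
  [set f | measurable_fun setT f /\ bounded_fun (f : X -> R^o)].

Definition bounded_setfun mu :=
  exists M : R, forall E, measurable E -> `|mu E| <= M.

Definition ba : set (set X -> R) :=
  [set mu | measure_function.semi_additive (EFin \o mu) /\ bounded_setfun mu].

Definition ca : set (set X -> R) :=
  [set mu | ba mu /\ semi_sigma_additive (EFin \o mu)].

Definition nonneg mu := forall E, measurable E -> 0 <= mu E.

Definition le_setfun la mu := forall E, measurable E -> la E <= mu E.

Definition null_setfun mu := forall E, measurable E -> mu E = 0.

(* The components of the Jordan decomposition mu = mu^+ - mu^- in the vector
   lattice of bounded finitely additive measures: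
   mu^+ (E) = sup {mu F | F `<=` E} and mu^- = (- mu)^+. Unlike a Hahn
   decomposition, this makes sense without countable additivity. *)
Definition fa_jordan_pos mu : set X -> R :=
  fun E => sup [set mu F | F in [set F | measurable F /\ F `<=` E]].

Definition fa_jordan_neg mu : set X -> R :=
  fa_jordan_pos (fun E => - mu E).

Definition purely_fa_nonneg mu :=
  forall la, ca la -> nonneg la -> le_setfun la mu -> null_setfun la.

(* For nonnegative [mu] the Jordan components are [mu] and 0, so this covers
   nonnegative and signed measures at once. *)
Definition pfa : set (set X -> R) :=
  [set mu | [/\ ba mu, purely_fa_nonneg (fa_jordan_pos mu)
              & purely_fa_nonneg (fa_jordan_neg mu)]].

(* The value at [f] of the sup-norm continuous extension of the integral of
   simple functions: the limit of [sintegral mu s] as the simple function [s]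
   tends uniformly to [f]. It exists and is unique for [ba mu] and [B f]. *)
Definition is_radon_integral mu f (l : R) :=
  forall e : R, 0 < e -> exists2 delta : R, 0 < delta &
    forall s : {sfun X >-> R}, (forall x, `|f x - s x| <= delta) ->
      (`|sintegral (EFin \o mu) s - l%:E| <= e%:E)%E.

Definition radon_integral mu f : R := get (is_radon_integral mu f).

Definition pfa_kernel (P : X -> set X -> R) :=
  [/\ forall x E, measurable E -> 0 <= P x E <= 1,
      forall E, measurable E -> B (fun x => P x E),
      forall x, pfa (P x)
    & forall x, P x setT = 1].

Definition markov_op (P : X -> set X -> R) mu : set X -> R :=
  fun E => radon_integral mu (fun x => P x E).

Definition fixed_by (A : (set X -> R) -> set X -> R) mu :=
  forall E, measurable E -> A mu E = mu E.

(* In [V] and [Delta], [K] is one of [ba], [ca], [pfa]. *)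
Definition V (K : set (set X -> R)) : set (set X -> R) :=
  [set mu | [/\ K mu, nonneg mu & mu setT <= 1]].

Definition Delta (K : set (set X -> R)) (A : (set X -> R) -> set X -> R) :
    set (set X -> R) :=
  [set mu | [/\ V K mu, ~ null_setfun mu & fixed_by A mu]].

End set_functions.

Arguments B {d} X R.
Arguments ba {d} X R.
Arguments ca {d} X R.
Arguments pfa {d} X R.

Definition immeasurable d (X : measurableType d) (R : realType) :=
  forall nu : {finite_measure set X -> \bar R},
    (forall x, nu [set x] = 0%E) -> forall E, measurable E -> nu E = 0%E.

(* [R] only serves as the codomain of the measures in [immeasurable]. *)
Definition arbitrary_discrete_space d (X : measurableType d) (R : realType) :=
  [/\ infinite_set [set: X], forall E : set X, measurable E
    & immeasurable X R].

(* Main.v *)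
From HB Require Import structures.
Require Import Defs.
From mathcomp Require Import all_boot all_order all_algebra.
From mathcomp Require Import all_classical all_reals all_analysis.
From mathcomp Require Import lra.

Local Open Scope classical_set_scope.
Local Open Scope ring_scope.

Set Implicit Arguments.
Unset Strict Implicit.
Unset Printing Implicit Defensive.

Import Order.TTheory GRing.Theory Num.Theory.
Import numFieldNormedType.Exports HBSimple.

(** Every invariant measure is purely finitely additive for a simple reason.  A
    purely finitely additive measure on a discrete space charges no point, since
    otherwise it would dominate a multiple of a Dirac measure ([pfa_point]).  Hence
    [P x [set y] = 0] for all [x] and [y], and [A mu] charges no point whatever
    [mu] is ([invariant_point]).  A countably additive measure below an invariant
    [mu] then charges no point either, so it vanishes because the cardinality is
    immeasurable ([immeasurable_null]); in particular an invariant countably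
    additive measure vanishes.

    An invariant probability charge exists for every kernel of finitely additive
    probabilities ([exists_invariant_charge]).  Start from a Dirac measure and set
    [nu E = L (fun k => A^k dirac E)] for a Banach limit [L], that is, a positive
    normalised shift-invariant linear functional on bounded sequences
    ([banach_limit]).  Integrals of simple functions are finite sums, so they
    commute with [L]; integrals of bounded functions commute with [L] too, since
    simple functions approximate them uniformly, with an error bound that is the
    same for all the probability charges [A^k dirac].  Applied to [P^~ E] this gives
    [A nu E = L (fun k => A^(k+1) dirac E) = nu E] by shift-invariance.

    The Radon integral against a nonnegative charge is computed as a lower
    integral, the supremum of the integrals of the simple functions below the
    integrand: it is total, and the error estimate [lower_integral_approx] makes
    every property of it a consequence of uniform approximation. *)

(** * Integration against a finitely additive measure *)

Section finitely_additive_integral.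
Context {T : Type} {R : realType}.
Implicit Types (mu : set T -> R) (f g s t : T -> R).

Definition fin_additive mu :=
  mu set0 = 0 /\
  forall A B, A `&` B = set0 -> mu (A `|` B) = mu A + mu B.

Definition is_simple s := finite_set (range s).

Definition simple_integral mu s : R :=
  \sum_(a \in range s) a * mu (s @^-1` [set a]).

Definition lower_integral mu f : R :=
  sup [set simple_integral mu s | s in
        [set s | is_simple s /\ forall x, s x <= f x]].

Lemma fin_additive_fibers mu (I : eqType) (g : T -> I) (r : seq I) :
  fin_additive mu -> uniq r ->
  mu (g @^-1` [set` r]) = \sum_(i <- r) mu (g @^-1` [set i]).
Proof.
move=> [mu0 muU]; elim: r => [_|i r IH /= /andP[ir ur]].
  rewrite big_nil -[RHS]mu0; congr mu.
  by apply/seteqP; split => x /=.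
rewrite big_cons -IH// -muU.
  congr mu; apply/seteqP; split => x /=.
    by rewrite in_cons => /orP[/eqP ->|]; [left|right].
  by rewrite in_cons; case=> [->|->]; rewrite ?eqxx ?orbT.
apply/seteqP; split => x //= -[] gi /=.
by rewrite gi; move/negP: ir.
Qed.

(** This formula allows any finite partition that refines the one of the level
    sets, which is what makes two simple functions comparable term by term. *)
Lemma simple_integral_comp mu (I : finType) (g : T -> I) (h : I -> R) :
  fin_additive mu ->
  simple_integral mu (h \o g) = \sum_(i : I) h i * mu (g @^-1` [set i]).
Proof.
move=> amu; pose r := undup [seq h i | i <- enum I].
(* The values of [h] outside the range of [h \o g] contribute [mu set0 = 0]. *)
rewrite /simple_integral (fsbig_widen _ [set` r]); last 2 first.
- move=> _ [x _ <-] /=; rewrite mem_undup; apply/mapP.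
  by exists (g x) => //; rewrite mem_enum.
- move=> a [_ nra] /=; rewrite (_ : (h \o g) @^-1` [set a] = set0).
    by rewrite (proj1 amu) mulr0.
  by apply/seteqP; split => x //= hx; exfalso; apply: nra; exists x.
rewrite -fsbig_seq ?undup_uniq//.
have fib a : mu ((h \o g) @^-1` [set a]) =
    \sum_(i <- enum I | h i == a) mu (g @^-1` [set i]).
  rewrite -big_filter -(fin_additive_fibers g)//.
    congr (mu _); apply/seteqP; split => x /=.
      by move=> ?; rewrite mem_filter mem_enum andbT; apply/eqP.
    by rewrite mem_filter => /andP[/eqP].
  by rewrite filter_uniq// enum_uniq.
under eq_bigr do rewrite fib mulr_sumr.
rewrite (exchange_big_dep xpredT)//= big_enum /=.
apply: eq_bigr => i _; rewrite -big_filter (_ : [seq a <- r | h i == a] = [:: h i]).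
  by rewrite big_seq1.
rewrite (eq_filter (a2 := pred1 (h i))) => [|a]; last by rewrite /= eq_sym.
rewrite filter_pred1_uniq// ?undup_uniq// mem_undup; apply/mapP.
by exists i => //; rewrite mem_enum.
Qed.

(** The pair of the two functions has finite range, so both factor through it and
    their integrals become sums over one common finite set of fibres. *)
Lemma simple_common_factor s t : is_simple s -> is_simple t ->
  exists (I : finType) (g : T -> I) (h k : I -> R), s = h \o g /\ t = k \o g.
Proof.
have factor u : is_simple u ->
    exists n (g : T -> 'I_n) (h : 'I_n -> R), u = h \o g.
  move=> /finite_seqP[r rE].
  have ur x : u x \in r.
    suff : [set` r] (u x) by [].
    by rewrite -rE; exists x.
  have idx x : (index (u x) r < size r)%N by rewrite index_mem.
  exists (size r), (fun x => Ordinal (idx x)), (fun i => nth 0 r i).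
  by apply/funext => x /=; rewrite nth_index.
move=> /factor[m [g [h ->]]] /factor[n [g' [h' ->]]].
by exists ('I_m * 'I_n)%type, (fun x => (g x, g' x)), (h \o fst), (h' \o snd).
Qed.

Lemma simpleD s t : is_simple s -> is_simple t -> is_simple (s \+ t).
Proof.
move=> ss st; have [I [g [h [k [-> ->]]]]] := simple_common_factor ss st.
apply: (@sub_finite_set _ _ [set h i + k i | i in [set: I]]).
  by move=> _ [x _ <-] /=; exists (g x).
exact: finite_image.
Qed.

Lemma simple_cst (c : R) : is_simple (cst c : T -> R).
Proof.
by apply: (@sub_finite_set _ _ [set c]) => [_ [x _ <-]|] //.
Qed.

Lemma simple_integralD mu s t : fin_additive mu -> is_simple s -> is_simple t ->
  simple_integral mu (s \+ t) = simple_integral mu s + simple_integral mu t.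
Proof.
move=> amu ss st; have [I [g [h [k [-> ->]]]]] := simple_common_factor ss st.
rewrite (_ : _ \+ _ = (h \+ k) \o g)// !simple_integral_comp// -big_split/=.
by apply: eq_bigr => i _; rewrite mulrDl.
Qed.

Lemma simple_integral_cst mu c : fin_additive mu ->
  simple_integral mu (cst c) = c * mu setT.
Proof.
move=> amu; rewrite (_ : cst c = (fun=> c) \o (fun=> tt : unit))//.
rewrite simple_integral_comp// -mulr_sumr; congr (_ * _).
rewrite (big_pred1 tt) => [|[]//].
by congr (mu _); apply/seteqP; split => x.
Qed.

Lemma simple_integral_le mu s t : fin_additive mu -> (forall A, 0 <= mu A) ->
  is_simple s -> is_simple t -> (forall x, s x <= t x) ->
  simple_integral mu s <= simple_integral mu t.
Proof.
move=> amu mu0 ss st; have [I [g [h [k [-> ->]]]]] := simple_common_factor ss st.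
move=> hk; rewrite !simple_integral_comp//; apply: ler_sum => i _.
(* [h i <= k i] is known only when [i] is a value of [g]. *)
have [->|/set0P[x <-]] := eqVneq (g @^-1` [set i]) set0.
  by rewrite (proj1 amu) !mulr0.
by rewrite ler_wpM2r// hk.
Qed.

(** The function [s - delta] is one of the simple functions below [f], and all of
    these lie below [s + delta]; so the supremum is squeezed between the integrals
    of [s - delta] and [s + delta]. *)
Lemma lower_integral_approx mu f s (delta : R) :
  fin_additive mu -> (forall A, 0 <= mu A) -> is_simple s ->
  (forall x, `|f x - s x| <= delta) ->
  `|simple_integral mu s - lower_integral mu f| <= delta * mu setT.
Proof.
move=> amu mu0 ss fs.
have shift c : is_simple (s \+ cst c) by apply: simpleD => //; exact: simple_cst.
have shiftE c : simple_integral mu (s \+ cst c) =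
    simple_integral mu s + c * mu setT.
  by rewrite simple_integralD ?simple_integral_cst//; exact: simple_cst.
have up : ubound [set simple_integral mu s | s in
     [set s | is_simple s /\ forall x, s x <= f x]]
     (simple_integral mu s + delta * mu setT).
  move=> _ [t [st tf] <-]; rewrite -shiftE; apply: simple_integral_le => // x /=.
  by move: (tf x) (fs x); rewrite ler_norml => ? /andP[]; lra.
have low : [set simple_integral mu s | s in
     [set s | is_simple s /\ forall x, s x <= f x]]
     (simple_integral mu s + (- delta) * mu setT).
  rewrite -shiftE; exists (s \+ cst (- delta)) => //; split => // x /=.
  by move: (fs x); rewrite ler_norml => /andP[]; lra.
have /= h1 := ub_le_sup (ex_intro _ _ up) low.
have /= h2 := ge_sup (ex_intro _ _ low) up.
by rewrite ler_norml /lower_integral; lra.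
Qed.

(** Round [f] down to a multiple of [delta]; the shift by [M] makes the rounded
    quantity nonnegative, so that [Num.truncn] is its floor. *)
Lemma simple_approx f (M delta : R) : (forall x, `|f x| <= M) -> 0 < delta ->
  exists2 s, is_simple s & forall x, `|f x - s x| <= delta.
Proof.
move=> fM d0; pose k x := Num.truncn ((f x + M) / delta).
have fM0 x : 0 <= (f x + M) / delta.
  by rewrite divr_ge0 ?(ltW d0)//; move: (fM x); rewrite ler_norml => /andP[]; lra.
exists (fun x => delta * (k x)%:R - M); last first.
  move=> x; have := truncn_itv (fM0 x); rewrite -/(k x) => /andP[].
  rewrite ler_pdivlMr// ltr_pdivrMr// -natr1 => h1 h2.
  by rewrite ler_norml; apply/andP; split; lra.
pose N := Num.truncn ((M + M) / delta).
apply: (@sub_finite_set _ _ [set delta * (i : nat)%:R - M | i in [set: 'I_N.+1]]).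
  move=> _ [x _ <-] /=.
  have kN : (k x < N.+1)%N.
    rewrite ltnS; apply: le_truncn; rewrite ler_pM2r ?invr_gt0//.
    by move: (fM x); rewrite ler_norml => /andP[]; lra.
  by exists (Ordinal kN).
exact: finite_image.
Qed.

Lemma lower_integral_simple mu s : fin_additive mu -> (forall A, 0 <= mu A) ->
  is_simple s -> lower_integral mu s = simple_integral mu s.
Proof.
move=> amu mu0 ss; have := @lower_integral_approx mu s s 0 amu mu0 ss.
rewrite mul0r => /(_ _)/wrap[x|]; first by rewrite subrr normr0.
by rewrite normr_le0 subr_eq0 => /eqP.
Qed.

Lemma lower_integral_ge0 mu f M : fin_additive mu -> (forall A, 0 <= mu A) ->
  (forall x, 0 <= f x <= M) -> 0 <= lower_integral mu f.
Proof.
move=> amu mu0 fM; apply: ub_le_sup.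
  exists (M * mu setT) => _ [s [ss sf] <-].
  rewrite -simple_integral_cst//; apply: simple_integral_le => //.
    exact: simple_cst.
  by move=> x /=; have /andP[_] := fM x; apply: le_trans.
exists (cst 0); last by rewrite simple_integral_cst ?mul0r.
by split; [exact: simple_cst|move=> x; have /andP[] := fM x].
Qed.

Lemma eq_of_dist_le (a b C : R) :
  (forall delta, 0 < delta -> `|a - b| <= delta * C) -> a = b.
Proof.
move=> h; apply/eqP; rewrite -subr_eq0 -normr_le0; apply/ler_addgt0Pr => e e0.
rewrite add0r; apply: (le_trans (h (e / (`|C| + 1)) _)).
  by rewrite divr_gt0// ltr_wpDl.
rewrite -mulrA ler_piMr ?(ltW e0)// ler_pdivrMl ?ltr_wpDl// mulr1.
by rewrite (le_trans (ler_norm C))// lerDl.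
Qed.

Lemma lower_integralD mu f g M N : fin_additive mu -> (forall A, 0 <= mu A) ->
  (forall x, `|f x| <= M) -> (forall x, `|g x| <= N) ->
  lower_integral mu (f \+ g) = lower_integral mu f + lower_integral mu g.
Proof.
move=> amu mu0 fM gN; apply: (@eq_of_dist_le _ _ (4 * mu setT)) => e e0.
have [s ss fs] := simple_approx fM e0; have [t st gt] := simple_approx gN e0.
have fgst x : `|(f \+ g) x - (s \+ t) x| <= e + e.
  move: (fs x) (gt x) => /=; rewrite !ler_norml => /andP[? ?] /andP[? ?].
  by apply/andP; split; lra.
have := lower_integral_approx amu mu0 (simpleD ss st) fgst.
have := lower_integral_approx amu mu0 ss fs.
have := lower_integral_approx amu mu0 st gt.
rewrite simple_integralD// !ler_norml.
by move=> /andP[? ?] /andP[? ?] /andP[? ?]; apply/andP; split; lra.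
Qed.

End finitely_additive_integral.

(** * The Radon integral on a discrete space *)

Section radon.
Context {d} {X : measurableType d} {R : realType}.
Context (discX : forall E : set X, measurable E).
Implicit Types (mu : set X -> R).

Lemma sintegral_simple mu (s : X -> R) : is_simple s -> mu set0 = 0 ->
  sintegral (EFin \o mu) s = (simple_integral mu s)%:E.
Proof.
move=> ss mu0; rewrite /sintegral -(fsbig_widen (range s) setT)//; last first.
  move=> a [_ /= nsa]; rewrite (_ : s @^-1` [set a] = set0) ?mu0 ?mule0//.
  by apply/seteqP; split => x //= sx; exfalso; apply: nsa; exists x.
by rewrite /simple_integral -fsumEFin//.
Qed.

(** The lower integral is a limit of the integrals of simple functions by
    [lower_integral_approx].  The limit is unique because simple functions
    arbitrarily close to [f] exist, so it is the one that [get] selects. *)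
Lemma radon_integralE mu f M : fin_additive mu -> (forall A, 0 <= mu A) ->
  (forall x, `|f x| <= M) -> radon_integral mu f = lower_integral mu f.
Proof.
move=> amu mu0 fM; have lf : is_radon_integral mu f (lower_integral mu f).
  (* Adding 1 keeps the denominator positive when [mu] is null. *)
  move=> e e0; have d0 : 0 < e / (mu setT + 1) by rewrite divr_gt0// ltr_wpDl.
  exists (e / (mu setT + 1)) => // s fs.
  have ss : is_simple s by exact: fimfunP.
  rewrite sintegral_simple ?(proj1 amu)// -EFinB abse_EFin lee_fin.
  apply: (le_trans (lower_integral_approx amu mu0 ss fs)).
  by rewrite -mulrA ler_piMr ?(ltW e0)// ler_pdivrMl ?ltr_wpDl// mulr1 lerDl.
have := getPex (ex_intro _ _ lf); rewrite -/(radon_integral mu f) => rf.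
apply: (@eq_of_dist_le _ _ _ 2) => e e0.
have [d1 d10 h1] := lf _ e0; have [d2 d20 h2] := rf _ e0.
have [s ss fs] : exists2 s, is_simple s &
    forall x, `|f x - s x| <= Num.min d1 d2.
  by apply: (simple_approx fM); rewrite lt_min d10.
pose sm := isMeasurableFun.phant_Build (fun (_ : measurable setT) (Y : set R)
  (_ : measurable Y) => discX (setT `&` s @^-1` Y)).
pose sf := FiniteImage.phant_Build ss.
pose S : {sfun X >-> R} := HB.pack s sm sf.
have := h1 S; have := h2 S; rewrite sintegral_simple ?(proj1 amu)//.
rewrite -!EFinB !abse_EFin !lee_fin.
move=> /(_ _)/wrap[x|h2']; first by rewrite (le_trans (fs x))// ge_min lexx orbT.
move=> /(_ _)/wrap[x|h1']; first by rewrite (le_trans (fs x))// ge_min lexx.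
move: h1' h2'; rewrite !ler_norml => /andP[? ?] /andP[? ?].
by apply/andP; split; lra.
Qed.

End radon.

(** * Banach limits *)

Definition cesaro {R : realType} (u : nat -> R) (n : nat) : R :=
  (\sum_(k < n.+1) u k) / n.+1%:R.

Definition bounded_seq {R : realType} (u : nat -> R) :=
  exists M, forall n, `|u n| <= M.

(** A set in a filter finer than [f @ U] has a preimage meeting every element of [U], so that
    preimage belongs to [U]. *)
Lemma fmap_ultra {S T : Type} (f : S -> T) (U : set_system S) :
  UltraFilter U -> UltraFilter (f @ U).
Proof.
move=> UU; split; first exact: fmap_proper_filter.
move=> G PG fUG; apply/seteqP; split => [A GA|]//.
have [//|nA] := in_ultra_setVsetC (f @^-1` A) UU.
have GnA : G (~` A) by exact: fUG.
have G0 : G set0 by rewrite -(setICr A); exact: filterI.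
by case: (@filter_not_empty _ G PG G0).
Qed.

Lemma ultra_cvg {R : realType} (U : set_system nat) (UU : UltraFilter U)
  (u : nat -> R) : bounded_seq u -> cvg (u n @[n --> U]).
Proof.
move=> [M uM]; have := @segment_compact R (- M) M; rewrite compact_ultra.
have uU : (u @ U) [set` `[- M, M]].
  by apply: (@filterE _ U) => n; rewrite /= in_itv/= -ler_norml.
move=> /(_ _ (fmap_ultra u UU) uU)[l [_ ul]].
by apply/cvg_ex; exists l.
Qed.

Lemma cesaro_bound {R : realType} (u : nat -> R) a b :
  (forall n, a <= u n <= b) -> forall n, a <= cesaro u n <= b.
Proof.
move=> uab n; rewrite /cesaro ler_pdivlMr ?ltr0n// ler_pdivrMr ?ltr0n//.
have cE c : c * n.+1%:R = \sum_(k < n.+1) c :> R.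
  by rewrite sumr_const card_ord mulr_natr.
by rewrite !cE !ler_sum// => k _; have /andP[] := uab k.
Qed.

(** The limit of the Cesaro means along a free ultrafilter: it exists by
    compactness of segments, and it is shift-invariant because a shift changes the
    [n]-th mean by [(u n.+1 - u 0) / n.+1], which tends to 0. *)
Lemma banach_limit (R : realType) : exists L : (nat -> R) -> R,
  [/\ forall u v, bounded_seq u -> bounded_seq v -> L (u \+ v) = L u + L v,
      forall c u, bounded_seq u -> L (fun n => c * u n) = c * L u,
      forall a b u, (forall n, a <= u n <= b) -> a <= L u <= b
    & forall u, bounded_seq u -> L (fun n => u n.+1) = L u].
Proof.
have [U [UU sU]] := ultraFilterLemma (@eventually_filter).
have cb u : bounded_seq u -> bounded_seq (cesaro u).
  move=> [M uM]; exists M => n; rewrite ler_norml.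
  by apply: cesaro_bound => k; rewrite -ler_norml.
have cu u : bounded_seq u -> cvg (cesaro u n @[n --> U]) by move=> /cb; exact: ultra_cvg.
exists (fun u => lim (cesaro u n @[n --> U])); split.
- move=> u v bu bv; rewrite -limD; [|exact: cu..].
  congr (lim (_ @ U)); apply/funext => n.
  by rewrite /cesaro/= big_split mulrDl.
- move=> c u bu; apply: cvg_lim => //.
  rewrite (_ : cesaro _ = (fun n => c * cesaro u n)).
    by apply: cvgM; [exact: cvg_cst|exact: cu].
  by apply/funext => n; rewrite /cesaro -mulr_sumr mulrA.
- move=> a b u uab; have bu : bounded_seq u.
    exists (Num.max `|a| `|b|) => n; have := uab n.
    move: (ler_norm b) (ler_norm (- a)); rewrite normrN le_max => ? ? /andP[? ?].
    by have [?|?] := ger0P (u n); apply/orP; [right|left]; lra.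
  apply/andP; split; [apply: limr_ge|apply: limr_le]; try exact: cu;
    by apply: filterE => n; have /andP[] := cesaro_bound uab n.
- move=> u [M uM]; have bu : bounded_seq u by exists M.
  have bu1 : bounded_seq (fun n => u n.+1) by exists M.
  apply/eqP; rewrite -subr_eq0; apply/eqP; rewrite -limB; [|exact: cu..].
  have to0 : (u n.+1 - u 0%N) / n.+1%:R @[n --> \oo] --> 0.
    apply/cvgr0Pnorm_le => e e0; near=> n.
    rewrite normrM normfV normr_nat ler_pdivrMr ?ltr0n//.
    apply: (le_trans (ler_normB _ _)); apply: (le_trans (lerD (uM _) (uM _))).
    rewrite -ler_pdivrMl// (le_trans (y := n%:R)) ?ler_nat//.
    near: n; exact: nbhs_infty_ger.
  apply: cvg_lim => //.
  rewrite (_ : cesaro _ - cesaro u = (fun n => (u n.+1 - u 0%N) / n.+1%:R)).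
    by move=> A /to0; exact: sU.
  apply/funext => n; rewrite !fctE /cesaro -mulrBl; congr (_ / _).
  rewrite big_ord_recr [X in _ - X]big_ord_recl /=.
  have -> : \sum_(i < n) u (bump 0 i) = \sum_(i < n) u i.+1 by [].
  by lra.
Unshelve. all: by end_near. Qed.

(** * Invariant probability charges *)

Section invariant_charge.
Context {T : Type} {R : realType}.
Implicit Types (mu : set T -> R) (P : T -> set T -> R).

Definition prob_charge mu :=
  [/\ fin_additive mu, forall A, 0 <= mu A & mu setT = 1].

Lemma fin_additive_le mu A B : fin_additive mu -> (forall A, 0 <= mu A) ->
  A `<=` B -> mu A <= mu B.
Proof.
move=> [_ muU] mu0 AB; rewrite -(setUIDK B A) (setIidr AB) muU ?lerDl//.
by apply/seteqP; split => x //= [? []].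
Qed.

Lemma prob_charge_le1 mu A : prob_charge mu -> 0 <= mu A <= 1.
Proof. by move=> [amu mu0 <-]; rewrite mu0 fin_additive_le. Qed.

Lemma prob_charge_dirac (a : T) : prob_charge (fun A => \1_A a : R).
Proof.
split => [|A|]; last 2 first.
- by rewrite indicE.
- by rewrite indicT.
split; first by rewrite indic0.
move=> A B AB; rewrite !indicE in_setU.
have [aA|//] := boolP (a \in A); have [aB|_] := boolP (a \in B); rewrite ?addr0//.
  have : (A `&` B) a by split; apply: set_mem.
  by rewrite AB.
by rewrite add0r.
Qed.

(** The operator preserves the total mass and the value at [set0] because [P^~ E] is
    constant for [E = setT] and [E = set0]; it preserves additivity because the
    integral is additive in the integrand. *)
Lemma prob_charge_markov P mu : (forall x, prob_charge (P x)) ->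
  prob_charge mu -> prob_charge (fun E => lower_integral mu (P^~ E)).
Proof.
move=> hP [amu mu0 mu1].
have P1 E x : 0 <= P x E <= 1 by exact: prob_charge_le1.
have normP1 E x : `|P x E| <= 1 by have /andP[P0 ?] := P1 E x; rewrite ger0_norm.
have fixed c E : (forall x, P x E = c) -> lower_integral mu (P^~ E) = c.
  move=> PE; rewrite (_ : P^~ E = cst c); last by apply/funext.
  rewrite lower_integral_simple ?simple_integral_cst ?mu1 ?mulr1//.
  exact: simple_cst.
split; [split|by move=> E; exact: (@lower_integral_ge0 _ _ mu _ 1)|].
- by apply: fixed => x; have [[]] := hP x.
- move=> A B AB; rewrite -(lower_integralD amu mu0 (normP1 A) (normP1 B)).
  by congr lower_integral; apply/funext => x /=; have [[_ ->]] := hP x.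
- by apply: fixed => x; have [] := hP x.
Qed.

(** The Krylov-Bogolyubov argument, with a Banach limit of the orbit of a Dirac
    measure in place of a weak limit point of its means. *)
Lemma exists_invariant_charge P (a : T) : (forall x, prob_charge (P x)) ->
  exists2 nu, prob_charge nu & forall E, lower_integral nu (P^~ E) = nu E.
Proof.
move=> hP; have [L [LD LZ Lle Lshift]] := banach_limit R.
pose A mu : set T -> R := fun E => lower_integral mu (P^~ E).
pose mus k := iter k A (fun E => \1_E a).
have hmus k : prob_charge (mus k).
  by elim: k => [|k IH]; [exact: prob_charge_dirac|exact: prob_charge_markov].
have amus k : fin_additive (mus k) by have [] := hmus k.
have mus0 k B : 0 <= mus k B by have [] := hmus k.
have bmus E : bounded_seq (fun k => mus k E).
  exists 1 => k; have /andP[? ?] := prob_charge_le1 E (hmus k).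
  by rewrite ger0_norm.
have Lcst c : L (fun=> c) = c.
  by apply/eqP; rewrite eq_le andbC; apply: Lle => _; rewrite lexx.
have bsum (I : finType) (u : I -> nat -> R) (r : seq I) :
    (forall i, bounded_seq (u i)) -> bounded_seq (fun k => \sum_(i <- r) u i k).
  move=> bu; pose M i := projT1 (cid (bu i)).
  exists (\sum_(i <- r) M i) => k; rewrite (le_trans (ler_norm_sum _ _ _))//.
  by apply: ler_sum => i _; rewrite /M; case: cid.
have Lsum (I : finType) (u : I -> nat -> R) : (forall i, bounded_seq (u i)) ->
    L (fun k => \sum_(i : I) u i k) = \sum_(i : I) L (u i).
  move=> bu; elim: (index_enum I) => [|i r IH].
    by under eq_fun do rewrite big_nil; rewrite Lcst big_nil.
  under eq_fun do rewrite big_cons.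
  by rewrite LD//; [rewrite IH big_cons|exact: bsum].
pose nu E := L (fun k => mus k E).
have hnu : prob_charge nu.
  split; [split|move=> E|].
  - by rewrite /nu; under eq_fun do rewrite (proj1 (amus _)); rewrite Lcst.
  - move=> B C BC; rewrite /nu -LD//; congr L; apply/funext => k.
    exact: (proj2 (amus k)).
  - have /andP[//] := Lle 0 1 (fun k => mus k E) (fun k => prob_charge_le1 E (hmus k)).
  - by rewrite /nu (_ : (fun k => _) = fun=> 1)//; apply/funext => k; have [] := hmus k.
exists nu => // E; have [anu nu0 nu1] := hnu.
have bZ c (u : nat -> R) : bounded_seq u -> bounded_seq (fun k => c * u k).
  by move=> [M uM]; exists (`|c| * M) => k; rewrite normrM ler_wpM2l.
(* Integrals of simple functions commute with [L], being finite sums. *)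
have nu_simple s : is_simple s ->
    bounded_seq (fun k => simple_integral (mus k) s) /\
    simple_integral nu s = L (fun k => simple_integral (mus k) s).
  move=> ss; have [I [g [h [_ [-> _]]]]] := simple_common_factor ss ss.
  under eq_fun do rewrite simple_integral_comp//.
  have b i : bounded_seq (fun k => h i * mus k (g @^-1` [set i])) by exact: bZ.
  split; first exact: bsum.
  by rewrite simple_integral_comp// Lsum//; apply: eq_bigr => i _; rewrite LZ.
have nuE : L (fun k => mus k.+1 E) = nu E by exact: (Lshift (fun k => mus k E)).
(* Compare both sides with [L] of the integrals of a simple function [s] within
   [e] of [P^~ E]; each comparison costs at most [e], all total masses being 1. *)
rewrite -nuE; apply: (@eq_of_dist_le _ _ _ 2) => e e0.
have PE x : `|P x E| <= 1.
  by have /andP[? ?] := prob_charge_le1 E (hP x); rewrite ger0_norm.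
have [s ss Ps] := simple_approx PE e0.
have [bs nus] := nu_simple s ss.
have b1 : bounded_seq (fun k => mus k.+1 E).
  by have [M hM] := bmus E; exists M.
have := lower_integral_approx anu nu0 ss Ps; rewrite nu1 mulr1 nus.
have : - e <= L (fun k => simple_integral (mus k) s + (- 1) * mus k.+1 E) <= e.
  apply: Lle => k; have [_ _ mus1] := hmus k.
  have := lower_integral_approx (amus k) (mus0 k) ss Ps.
  by rewrite mus1 mulr1 -ler_norml mulN1r.
rewrite (LD (fun k => simple_integral (mus k) s)) ?LZ//; last exact: bZ.
rewrite !ler_norml => /andP[? ?] /andP[? ?]; apply/andP; split; lra.
Qed.

End invariant_charge.

(** * Measures that charge no point *)

Section discrete_space.
Context {d} {X : measurableType d} {R : realType}.
Context (discX : forall E : set X, measurable E).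
Implicit Types mu la : set X -> R.

Lemma ba_fin_additive mu : ba X R mu -> fin_additive mu.
Proof.
move=> [smu _]; have mu0 : mu set0 = 0.
  have := smu (fun=> set0) 0%N (fun=> discX _) (@trivIset_set0 _ _ _) (discX _).
  by rewrite !big_ord0 /= => -[].
split => // A B AB; have emu0 : (EFin \o mu) set0 = 0%E by rewrite /= mu0.
have := semi_additiveW emu0 smu (discX A) (discX B) (discX _) AB.
by rewrite /= -EFinD => -[].
Qed.

Lemma fin_additive_ba mu : fin_additive mu -> (forall A, 0 <= mu A) -> ba X R mu.
Proof.
move=> amu mu0; split; last first.
  by exists (mu setT) => E _; rewrite ger0_norm ?fin_additive_le.
have emu0 : (EFin \o mu) set0 = 0%E by rewrite /= (proj1 amu).
apply/(additive2P emu0) => A B _ _ AB.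
by rewrite /= (proj2 amu).
Qed.

Lemma immeasurable_null la : immeasurable X R -> ca X R la -> nonneg la ->
  (forall x, la [set x] = 0) -> null_setfun la.
Proof.
move=> imX [bla sla] la0 lax E _.
have ela0 : (EFin \o la) set0 = 0%E.
  by rewrite /= (proj1 (ba_fin_additive bla)).
have ela_ge0 A : (0 <= (EFin \o la) A)%E by rewrite lee_fin la0.
have efin : fin_num_fun (EFin \o la) by [].
pose m1 := isMeasure.phant_Build ela0 ela_ge0 sla.
pose M : {measure set X -> \bar R} := HB.pack (EFin \o la) m1.
pose m2 := Measure_isFinite.Build _ _ _ M efin.
pose N : {finite_measure set X -> \bar R} := HB.pack (Measure.sort M) m2.
have NE : N E = 0%E.
  by apply: imX => // x; change ((la [set x])%:E = 0%E); rewrite lax.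
by case: NE.
Qed.

Lemma fa_jordan_pos_ge mu E : bounded_setfun mu -> mu E <= fa_jordan_pos mu E.
Proof.
move=> [M muM]; apply: ub_le_sup; last by exists E => //; split.
by exists M => _ [F [mF _] <-]; rewrite (le_trans (ler_norm _)) ?muM.
Qed.

Lemma fa_jordan_pos_le mu E c : (forall F, F `<=` E -> mu F <= c) ->
  fa_jordan_pos mu E <= c.
Proof.
move=> muc; apply: ge_sup; first by exists (mu E), E => //; split.
by move=> _ [F [_ FE] <-]; exact: muc.
Qed.

(** A countably additive measure below one of the Jordan components charges no
    point: the positive component of a nonnegative [mu] is at most [mu], and the
    negative one is at most 0. *)
Lemma pfa_of_points mu : immeasurable X R -> ba X R mu -> nonneg mu ->
  (forall x, mu [set x] = 0) -> pfa X R mu.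
Proof.
move=> imX bmu mu0 mux; have amu := ba_fin_additive bmu.
have null la nu : (forall x, nu [set x] <= 0) -> ca X R la -> nonneg la ->
    le_setfun la nu -> null_setfun la.
  move=> nux cla la0 lanu; apply: immeasurable_null => // x.
  by apply/eqP; rewrite eq_le la0// (le_trans (lanu _ _)).
split => // la cla la0 lamu; apply: (null _ _ _ cla la0 lamu) => x.
  apply: fa_jordan_pos_le => F Fx; rewrite -(mux x).
  by apply: fin_additive_le => // A; exact: mu0.
by apply: fa_jordan_pos_le => F _; rewrite oppr_le0 mu0.
Qed.

(** Otherwise [mu [set x]] times the Dirac measure at [x] would be a nonzero
    countably additive measure below [mu]. *)
Lemma pfa_point mu x : nonneg mu -> pfa X R mu -> mu [set x] = 0.
Proof.
move=> mu0 [bmu pmu _]; have amu := ba_fin_additive bmu.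
have c0 : 0 <= mu [set x] by exact: mu0.
pose la E : R := mu [set x] * \1_E x.
have laE : EFin \o la = mscale (NngNum c0) \d_x.
  by apply/funext => E; rewrite /la /mscale/= /dirac EFinM.
suff : la [set x] = 0 by rewrite /la indicE mem_set// mulr1.
have la0 E : 0 <= la E by rewrite mulr_ge0// indicE.
have cla : ca X R la.
  split; last by rewrite laE; exact: measure_semi_sigma_additive.
  split; first by rewrite laE; exact: measure_semi_additive.
  exists (mu [set x]) => E _; rewrite ger0_norm// /la indicE.
  by case: (_ \in _); rewrite ?mulr1 ?mulr0.
apply: pmu => // E _.
apply: le_trans (fa_jordan_pos_ge _ (proj2 bmu)); rewrite /la indicE.
have [xE|_] := boolP (x \in E); last by rewrite mulr0 mu0.
rewrite mulr1; apply: fin_additive_le => // [A|y ->]; first exact: mu0.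
exact: set_mem.
Qed.

Lemma prob_charge_pfa_kernel (P : X -> set X -> R) x :
  pfa_kernel P -> prob_charge (P x).
Proof.
move=> [P01 _ pP P1]; split => //; first by have [bP _ _] := pP x; exact: ba_fin_additive.
by move=> A; have /andP[] := P01 x A (discX A).
Qed.

Lemma markov_opE (P : X -> set X -> R) mu E : pfa_kernel P ->
  fin_additive mu -> (forall A, 0 <= mu A) ->
  markov_op P mu E = lower_integral mu (P^~ E).
Proof.
move=> hP amu mu0; apply: (@radon_integralE _ _ _ discX _ _ 1) => // x.
have /andP[? ?] := prob_charge_le1 E (prob_charge_pfa_kernel x hP).
by rewrite ger0_norm.
Qed.

(** The integrand [P^~ [set x]] is identically 0, by [pfa_point]. *)
Lemma invariant_point (P : X -> set X -> R) mu x : pfa_kernel P ->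
  ba X R mu -> nonneg mu -> fixed_by (markov_op P) mu -> mu [set x] = 0.
Proof.
move=> hP bmu mu0 fmu; have amu := ba_fin_additive bmu.
have mu0' A : 0 <= mu A by exact: mu0.
have P0 : P^~ [set x] = cst 0.
  apply/funext => y; have [P01 _ pP _] := hP.
  by apply: pfa_point => // A mA; have /andP[] := P01 y A mA.
rewrite -fmu// markov_opE// P0 lower_integral_simple ?simple_integral_cst ?mul0r//.
exact: simple_cst.
Qed.

End discrete_space.

(** * Existence and pure finite additivity of invariant measures *)

Theorem theorem4p2 (R : realType) (d : measure_display) (X : measurableType d)
    (hX : arbitrary_discrete_space X R)
    (P : X -> set X -> R) (hP : pfa_kernel P) :
  (exists mu : set X -> R,
     [/\ V (ba X R) mu, mu setT = 1 & fixed_by (markov_op P) mu]) /\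
  (forall mu : set X -> R,
     ba X R mu -> nonneg mu -> fixed_by (markov_op P) mu -> pfa X R mu) /\
  Delta (ba X R) (markov_op P) = Delta (pfa X R) (markov_op P) /\
  Delta (ba X R) (markov_op P) <> set0 /\
  Delta (ca X R) (markov_op P) = set0.
Proof.
have [infX discX imX] := hX.
have [a _] := infinite_setN0 infX.
have ex : exists mu : set X -> R,
     [/\ V (ba X R) mu, mu setT = 1 & fixed_by (markov_op P) mu].
  have [nu [anu nu0 nu1] invnu] := exists_invariant_charge a
    (fun x => prob_charge_pfa_kernel discX x hP).
  exists nu; split => //.
    by split; [exact: fin_additive_ba|move=> E _; exact: nu0|rewrite nu1].
  by move=> E _; rewrite markov_opE.
have inv_pfa (mu : set X -> R) :
    ba X R mu -> nonneg mu -> fixed_by (markov_op P) mu -> pfa X R mu.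
  move=> bmu mu0 fmu; apply: pfa_of_points => // x.
  exact: (invariant_point discX x hP).
split=> //; split=> //; split; last split.
- apply/seteqP; split => mu [[bmu mu0 mu1] mun0 fmu]; split => //.
    by split => //; exact: inv_pfa.
  by split => //; case: bmu.
- have [mu [Vmu mu1 fmu]] := ex; move=> D0.
  suff : Delta (ba X R) (markov_op P) mu by rewrite D0.
  by split => // mu0; move: mu1; rewrite mu0// => /esym/eqP; rewrite oner_eq0.
- apply/seteqP; split => // mu [[cmu mu0 _] mun0 fmu] /=; apply: mun0.
  apply: (immeasurable_null discX imX cmu mu0) => x.
  exact: (invariant_point discX x hP (proj1 cmu)).
Qed.
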